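(* Let $n\ge 3$, and let $G_1,G_2,\ldots,G_n$ be (pairwise disjoint) connected graphs with $\lambda_1,\lambda_2,\ldots,\lambda_n$ vertices respectively (each $\lambda_i\ge 1$). Let $C_n$ be the cycle with vertex set $\{v_1,\ldots,v_n\}$ and edge set $\{v_iv_{i+1}\mid 1\le i\le n-1\}\cup\{v_nv_1\}$, disjoint from the $G_i$. Let $G$ be a graph obtained by connecting, for each $i$, the vertex $v_i$ of $C_n$ by an edge to an arbitrarily chosen vertex $u_i$ of $G_i$. If $G$ has a connected partition of type $\mu$, then the sun graph $S(n;\lambda_1,\lambda_2,\ldots,\lambda_n)$ also has a connected partition of type $\mu$.
   Context: All graphs are finite and simple. $P_k$ denotes the path with $k$ vertices; for $k=1$ the single vertex counts as its leaf. For $n\ge 3$ and positive integers $\lambda_1,\ldots,\lambda_n$, the sun graph $S(n;\lambda_1,\ldots,\lambda_n)$ is obtained from the cycle $C_n$ with consecutive vertices $v_1,\ldots,v_n$ and $n$ disjoint paths $P_{\lambda_1},\ldots,P_{\lambda_n}$ (disjoint from the cycle) by connecting $v_i$ by an edge to a leaf of $P_{\lambda_i}$ for every $i$. A connected partition of a graph $G$ is a partition $\{V_1,\ldots,V_k\}$ of its vertex set such that every induced subgraph $G[V_i]$ is connected; its type is the integer partition whose parts are the sizes $|V_1|,\ldots,|V_k|$ (in weakly decreasing order). *)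

(* Defs.v *)
From mathcomp Require Import all_boot.

Set Implicit Arguments.
Unset Strict Implicit.
Unset Printing Implicit Defensive.

Record sgraph := SGraph {
  vertex :> finType;
  edge : rel vertex;
  edge_sym : symmetric edge;
  edge_irrefl : irreflexive edge }.

Definition connected_graph (G : sgraph) : bool :=
  (0 < #|G|) && [forall x : G, forall y : G, connect (@edge G) x y].

Section Induced.
Variables (G : sgraph) (A : {set G}).

Definition induced_edge : rel {x : G | x \in A} :=
  fun x y => edge (val x) (val y).

Lemma induced_edge_sym : symmetric induced_edge.
Proof. by move=> x y; apply: edge_sym. Qed.

Lemma induced_edge_irrefl : irreflexive induced_edge.
Proof. by move=> x; apply: edge_irrefl. Qed.

Definition induced : sgraph := SGraph induced_edge_sym induced_edge_irrefl.
End Induced.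

Definition connected_partition (G : sgraph) (P : {set {set G}}) : bool :=
  partition P [set: G] && [forall A in P, connected_graph (induced A)].

Definition partition_type (G : sgraph) (P : {set {set G}}) : seq nat :=
  sort geq [seq #|A| | A : {set G} in P].

Definition has_connected_partition (G : sgraph) (mu : seq nat) : Prop :=
  exists P : {set {set G}}, connected_partition P /\ partition_type P = mu.

Section Path.
Variable k : nat.

Definition path_edge : rel 'I_k :=
  fun i j => (i.+1 == j :> nat) || (j.+1 == i :> nat).

Lemma path_edge_sym : symmetric path_edge.
Proof. by move=> i j; rewrite /path_edge orbC. Qed.

Lemma path_edge_irrefl : irreflexive path_edge.
Proof. by move=> i; rewrite /path_edge orbb gtn_eqF. Qed.

Definition path_graph : sgraph := SGraph path_edge_sym path_edge_irrefl.
End Path.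

Section Cycle.
Variable n : nat.

(* [ordS] is the cyclic successor; [i != j] only excludes the loop at n = 1. *)
Definition cycle_edge : rel 'I_n :=
  fun i j => (i != j) && ((j == ordS i) || (i == ordS j)).

Lemma cycle_edge_sym : symmetric cycle_edge.
Proof. by move=> i j; rewrite /cycle_edge eq_sym orbC. Qed.

Lemma cycle_edge_irrefl : irreflexive cycle_edge.
Proof. by move=> i; rewrite /cycle_edge eqxx. Qed.

Definition cycle_graph : sgraph := SGraph cycle_edge_sym cycle_edge_irrefl.
End Cycle.

(* The disjoint union of C_n (left summand) and of the G i (right summand),
   together with the edges joining the cycle vertex i to u i. *)
Section CycleAttach.
Variables (n : nat) (G : 'I_n -> sgraph) (u : forall i, G i).

Definition attach_edge : rel (cycle_graph n + {i : 'I_n & G i}) :=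
  fun x y => match x, y with
  | inl i, inl j => edge i j
  | inl i, inr q => q == Tagged (fun i => G i : Type) (u i)
  | inr p, inl j => p == Tagged (fun i => G i : Type) (u j)
  | inr p, inr q => (tag p == tag q) && edge (tagged p) (tagged_as p q)
  end.

Lemma attach_edge_sym : symmetric attach_edge.
Proof.
case=> [i|[i a]] [j|[j b]] //=; first exact: cycle_edge_sym.
have [eqij|//] := eqVneq i j; subst j.
by rewrite !tagged_asE edge_sym.
Qed.

Lemma attach_edge_irrefl : irreflexive attach_edge.
Proof.
case=> [i|[i a]] /=; first exact: cycle_edge_irrefl.
by rewrite eqxx tagged_asE edge_irrefl.
Qed.

Definition cycle_attach : sgraph := SGraph attach_edge_sym attach_edge_irrefl.
End CycleAttach.

(* The vertex 0 of [path_graph k] is a leaf, the only vertex if k = 1; reversing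
   the path shows that taking its other leaf gives an isomorphic graph. *)
Definition sun_graph (n : nat) (lam : 'I_n -> nat)
    (lam_gt0 : forall i, 0 < lam i) : sgraph :=
  @cycle_attach n (fun i => path_graph (lam i))
    (fun i => Ordinal (lam_gt0 i)).

(* Main.v *)
Require Import Defs.
From mathcomp Require Import all_boot.

Set Implicit Arguments.
Unset Strict Implicit.
Unset Printing Implicit Defensive.

(** The pendant graph [G i] is only linked to the rest of the graph through the
edge joining [u i] to the cycle vertex [i].  Hence a connected part that meets
both [G i] and the cycle contains [i] ([foot_in_part]), so that at most one part
crosses that edge, and every part missing the cycle lies inside a single [G i]
([same_foot_off_cycle]).

List the vertices of every [G i] part by part, starting with the part of the
cycle vertex [i], and send the k-th of them to the k-th vertex of the i-th path,
counted from the cycle.  With the identity on the cycle, this is a bijection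
onto the vertices of the sun graph, so the images of the parts form a partition
of the same type ([transfer_connected_partition]).  These images are connected:
a part that misses the cycle becomes an interval of a path
([leg_interval_connect]); a part that meets the cycle keeps its trace on the
cycle, and its trace on [G i] becomes an initial segment of the i-th path, which
hangs from the cycle vertex [i] ([leg_foot_connect]).  Walking along an edge of
the part moves its foot on the cycle by at most one step, so the trace on the
cycle is connected. *)

(** * Connectivity inside a set of vertices *)

(** Walks of [induced G A], seen as walks of [G]; this avoids handling
membership proofs. *)
Definition within (G : sgraph) (A : {set G}) : rel G :=
  fun x y => [&& x \in A, y \in A & edge x y].

Lemma within_connect_sym (G : sgraph) (A : {set G}) :
  connect_sym (within A).
Proof.
apply: sym_connect_sym => x y.
by rewrite /within edge_sym; case: (x \in A); case: (y \in A).
Qed.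

Lemma connected_inducedP (G : sgraph) (A : {set G}) :
  reflect (A != set0 /\ {in A &, forall x y, connect (within A) x y})
          (connected_graph (induced A)).
Proof.
have cardA : #|induced A| = #|A| by rewrite /= card_sig; apply: eq_card => x.
apply: (iffP andP); rewrite cardA card_gt0 => -[ntA connA]; split=> //.
  move=> x y Ax Ay.
  have /connectP[p] := forallP (forallP connA (Sub x Ax)) (Sub y Ay).
  change (connect (within A) x y) with
    (connect (within A) (val (Sub x Ax : induced A))
                        (val (Sub y Ay : induced A))).
  move: (Sub x Ax : induced A) (Sub y Ay : induced A) => {Ax Ay}x' y' path_p ->.
  elim: p x' path_p => [|z p IHp] x' /=; first by rewrite connect0.
  case/andP=> xz /IHp; apply: connect_trans; apply: connect1.
  by rewrite /within (valP x') (valP z).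
apply/forallP=> x; apply/forallP=> y.
have /connectP[p path_p last_p] := connA _ _ (valP x) (valP y).
elim: p x path_p last_p => [|z p IHp] x /=.
  by move=> _ /val_inj ->; apply: connect0.
case/andP=> /and3P[Ax Az xz] path_p last_p.
apply: connect_trans (IHp (Sub z Az) path_p last_p).
exact: connect1.
Qed.

Lemma connect_invariant (T : finType) (e : rel T) (Q : T -> Prop) x y :
  (forall a b, e a b -> Q a -> Q b) -> connect e x y -> Q x -> Q y.
Proof.
move=> eQ /connectP[p path_p ->].
elim: p x path_p => //= z p IHp x /andP[xz path_p] Qx.
exact: IHp path_p (eQ _ _ xz Qx).
Qed.

(** * Transport of partitions along a bijection *)

Lemma partition_type_imset (G H : sgraph) (f : G -> H) (P : {set {set G}}) :
  injective f ->
  partition_type ((fun A : {set G} => f @: A) @: P) = partition_type P.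
Proof.
move=> injf; rewrite /partition_type.
apply/perm_sortP.
- by move=> a b; apply: leq_total.
- by move=> a b c /= ab bc; apply: leq_trans bc ab.
- by move=> a b; rewrite andbC; apply: anti_leq.
have -> : [seq #|A| | A : {set G} in P]
   = [seq #|A| | A : {set H} <- [seq f @: A | A : {set G} <- enum P]].
  by rewrite -map_comp; apply: eq_map => A /=; rewrite card_imset.
apply: perm_map; apply: uniq_perm; first exact: enum_uniq.
  by rewrite map_inj_uniq ?enum_uniq //; apply: imset_inj.
move=> B; rewrite mem_enum.
apply/imsetP/mapP => -[A PA ->]; exists A => //; by rewrite mem_enum in PA *.
Qed.

(** Types only see sizes, so the vertices may be relabelled by a bijection that
need not respect edges: keeping the parts of [P] connected is enough. *)
Lemma transfer_connected_partition (G H : sgraph) (f : G -> H)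
    (P : {set {set G}}) :
  bijective f -> connected_partition P ->
  (forall A, A \in P -> connected_graph (induced A) ->
     connected_graph (induced (f @: A))) ->
  has_connected_partition H (partition_type P).
Proof.
case=> g fK gK /andP[/and3P[/eqP covP trivP ntP] /forall_inP connP] connf.
have injf := can_inj fK.
exists ((fun A : {set G} => f @: A) @: P).
split; last exact: partition_type_imset.
apply/andP; split.
  apply/and3P; split; last 1 first.
  - apply: contra ntP => /imsetP[A PA /esym /eqP].
    by rewrite imset_eq0 => /eqP <-.
  - apply/eqP/setP=> y; rewrite inE.
    have: g y \in cover P by rewrite covP.
    case/bigcupP=> A PA Ay; apply/bigcupP.
    by exists (f @: A); [apply: imset_f | rewrite -[y]gK imset_f].
  by rewrite imset_trivIset.
by apply/forall_inP=> _ /imsetP[A PA ->]; apply: connf => //; apply: connP.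
Qed.

(** * Numbering a finite type by increasing key *)

Lemma monotone_numbering (T : finType) (m : nat) (key : T -> nat) :
  #|T| = m ->
  {g : T -> 'I_m | injective g & forall x y, g x <= g y -> key x <= key y}.
Proof.
move=> cardT; pose s := sort (relpre key leq) (enum T).
have mem_s x : x \in s by rewrite mem_sort mem_enum.
have lt_m x : index x s < m.
  by rewrite -cardT cardE -(size_sort (relpre key leq)) index_mem.
have tot : total (relpre key leq) by move=> x y; apply: leq_total.
have tr : transitive (relpre key leq) by move=> y x z; apply: leq_trans.
exists (fun x => Ordinal (lt_m x)).
  move=> x y [/(congr1 (nth x s))].
  by rewrite !nth_index.
move=> x y /= le_xy.
have refl : reflexive (relpre key leq) by move=> z; apply: leqnn.
exact: (sorted_leq_index tr refl (sort_sorted tot _)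
  x y (mem_s x) (mem_s y) le_xy).
Qed.

(** * Parts of a cycle with attached graphs *)

(** The cycle vertex from which a vertex hangs. *)
Definition foot (n : nat) (G : 'I_n -> sgraph) (u : forall i, G i)
    (x : cycle_attach u) : 'I_n :=
  match x with inl i => i | inr p => tag p end.

Section CycleAttachParts.
Variables (n : nat) (G : 'I_n -> sgraph) (u : forall i, G i).
Implicit Types (A : {set cycle_attach u}) (x y : cycle_attach u).

Definition on_cycle (i : 'I_n) : cycle_attach u := inl i.

Lemma foot_edge x y :
  edge x y -> foot x = foot y \/ cycle_edge (foot x) (foot y).
Proof.
case: x y => [i|p] [j|q] //=; first by right.
- by move/eqP=> ->; left.
- by move/eqP=> ->; left.
by case/andP=> /eqP eq_pq _; left.
Qed.

(** An edge changing the foot has both ends on the cycle, so a walk leaving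
[G i] to reach the cycle goes through its foot. *)
Lemma foot_in_part A (i : 'I_n) x :
  {in A &, forall y z, connect (within A) y z} ->
  on_cycle i \in A -> x \in A -> on_cycle (foot x) \in A.
Proof.
move=> connA Ai Ax; apply: contraT => Ax'.
suff: on_cycle (foot (on_cycle i)) \notin A by rewrite Ai.
apply: (@connect_invariant _ (within A)
  (fun y => on_cycle (foot y) \notin A) x _ _ (connA _ _ Ax Ai)) => //.
move=> y z /and3P[Ay Az]; case: y Ay => [j|p] Ay; first by rewrite Ay.
case: z Az => [j|q] Az /=; first by move/eqP=> -> /=; rewrite Az.
by case/andP=> /eqP eq_pq _; rewrite eq_pq.
Qed.

Lemma same_foot_off_cycle A :
  {in A &, forall y z, connect (within A) y z} ->
  (forall i, on_cycle i \notin A) -> {in A &, forall x y, foot x = foot y}.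
Proof.
move=> connA offA x y Ax Ay.
apply: (@connect_invariant _ (within A) (fun z => foot x = foot z) x y
  _ (connA x y Ax Ay)) => // a b /and3P[Aa Ab ab] ->.
case: a Aa ab => [j|p] Aa; first by rewrite (negPf (offA j)) in Aa.
case: b Ab => [j|q] Ab /=; first by rewrite (negPf (offA j)) in Ab.
by case/andP=> /eqP.
Qed.

End CycleAttachParts.
Arguments on_cycle {n G u}.

(** * Segments of the legs of a sun graph *)

Section SunLegs.
Variables (n : nat) (lam : 'I_n -> nat) (lam_gt0 : forall i, 0 < lam i).
Implicit Types (B : {set sun_graph lam_gt0}).

Definition leg (i : 'I_n) (k : 'I_(lam i)) : sun_graph lam_gt0 :=
  inr (Tagged (fun i => path_graph (lam i) : Type) k).
Arguments leg i k : clear implicits.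

Lemma leg_interval_connect B i (a b : 'I_(lam i)) :
  a <= b -> (forall k : 'I_(lam i), a <= k <= b -> leg i k \in B) ->
  connect (within B) (leg i a) (leg i b).
Proof.
case: b => b ltb /=; elim: b ltb => [|b IHb] ltb.
  rewrite leqn0 => /eqP a0 _.
  by have -> : a = Ordinal ltb; [apply: val_inj | apply: connect0].
rewrite leq_eqVlt => /predU1P[ab _ | ltab seg].
  by have -> : a = Ordinal ltb; [apply: val_inj | apply: connect0].
have ltb' := ltnW ltb.
apply: (@connect_trans _ _ (leg i (Ordinal ltb'))).
  apply: IHb => // k /andP[ak kb]; apply: seg.
  by rewrite ak (leq_trans kb).
apply: connect1; apply/and3P; split.
- by apply: seg; rewrite /= -ltnS ltab leqnSn.
- by apply: seg; rewrite /= ltnW /=.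
by rewrite /= eqxx tagged_asE /= /path_edge /= eqxx.
Qed.

Lemma leg_foot_connect B i (a : 'I_(lam i)) :
  on_cycle i \in B -> (forall k : 'I_(lam i), k <= a -> leg i k \in B) ->
  connect (within B) (leg i a) (on_cycle i).
Proof.
move=> Bi seg; pose o := Ordinal (lam_gt0 i).
apply: (@connect_trans _ _ (leg i o)).
  by rewrite within_connect_sym; apply: leg_interval_connect.
apply: connect1; apply/and3P; split; [exact: seg | exact: Bi | exact: eqxx].
Qed.

End SunLegs.
Arguments leg {n lam lam_gt0} i k.

(** * Straightening the attached graphs into paths *)

Section Straighten.
Variables (n : nat) (lam : 'I_n -> nat) (lam_gt0 : forall i, 0 < lam i).
Variables (G : 'I_n -> sgraph) (u : forall i, G i).
Variable g : forall i, G i -> 'I_(lam i).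

Definition hang (i : 'I_n) (a : G i) : cycle_attach u :=
  inr (Tagged (fun i => G i : Type) a).

Definition straighten (x : cycle_attach u) : sun_graph lam_gt0 :=
  match x with
  | inl i => on_cycle i
  | inr p => leg (tag p) (g (tagged p))
  end.

Lemma straighten_bij :
  (forall i, #|G i| = lam i) -> (forall i, injective (@g i)) ->
  bijective straighten.
Proof.
move=> cardG inj_g; apply: inj_card_bij.
  case=> [i|[i a]] [j|[j b]] //=; first by case=> ->.
  case=> eqij; subst j; move/eqP.
  by rewrite -tag_eqE /tag_eq /= eqxx tagged_asE /= => /eqP/inj_g ->.
rewrite !card_sum !card_tagged leq_add2l.
rewrite (@eq_map _ _ (fun i => #|path_graph (lam i)|) (fun i => #|G i|)) //.
by move=> i; rewrite cardG card_ord.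
Qed.

(** The image of each vertex of [A] slides down its leg to the foot; there the
steps of a walk in [A] project to steps along the cycle. *)
Lemma straighten_connected_on_cycle (A : {set cycle_attach u}) i0 :
  (forall i, bijective (@g i)) ->
  (forall i (a b : G i), hang a \in A -> g b <= g a -> hang b \in A) ->
  on_cycle i0 \in A ->
  {in A &, forall x y, connect (within A) x y} ->
  {in straighten @: A &, forall x y, connect (within (straighten @: A)) x y}.
Proof.
move=> bij_g initA Ai0 connA.
set B := straighten @: A.
have cycB i : on_cycle i \in A -> on_cycle i \in B.
  by move=> Ai; apply: (imset_f straighten Ai).
have footA x : x \in A -> on_cycle (foot x) \in A by apply: foot_in_part Ai0.
have to_foot x : x \in A ->
    connect (within B) (straighten x) (on_cycle (foot x)).
  case: x => [i|[i a]] Ax /=; first exact: connect0.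
  apply: leg_foot_connect => [|k]; first exact: cycB (footA _ Ax).
  have [h hK gK] := bij_g i; rewrite -(gK k) => le_ka.
  exact: (imset_f straighten (initA _ _ _ Ax le_ka)).
move=> _ _ /imsetP[x Ax ->] /imsetP[y Ay ->].
apply: connect_trans (to_foot x Ax) _.
rewrite within_connect_sym; apply: connect_trans (to_foot y Ay) _.
rewrite within_connect_sym.
apply: (@connect_invariant _ (within A)
  (fun z => connect (within B) (on_cycle (foot x)) (on_cycle (foot z)))
  x y _ (connA x y Ax Ay)); last exact: connect0.
move=> a b /and3P[Aa Ab ab] xa; apply: connect_trans xa _.
case/foot_edge: ab => [-> | ab]; first exact: connect0.
by apply: connect1; rewrite /within !cycB ?footA.
Qed.

(** Such a part has a single foot, so its image is one segment of one leg. *)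
Lemma straighten_connected_off_cycle (A : {set cycle_attach u}) :
  (forall i, bijective (@g i)) ->
  (forall i (a b c : G i), hang a \in A -> hang c \in A ->
     g a <= g b <= g c -> hang b \in A) ->
  (forall i, on_cycle i \notin A) ->
  {in A &, forall x y, connect (within A) x y} ->
  {in straighten @: A &, forall x y, connect (within (straighten @: A)) x y}.
Proof.
move=> bij_g convA offA connA.
have seg i (a c : G i) : hang a \in A -> hang c \in A -> g a <= g c ->
    connect (within (straighten @: A))
      (straighten (hang a)) (straighten (hang c)).
  move=> Aa Ac le_ac; apply: leg_interval_connect => // k.
  have [h hK gK] := bij_g i; rewrite -(gK k) => le_akc.
  exact: (imset_f straighten (convA _ _ _ _ Aa Ac le_akc)).
move=> _ _ /imsetP[x Ax ->] /imsetP[y Ay ->].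
have := same_foot_off_cycle connA offA Ax Ay.
case: x Ax => [i|[i a]] Ax; first by rewrite (negPf (offA i)) in Ax.
case: y Ay => [j|[j c]] Ay; first by rewrite (negPf (offA j)) in Ay.
move=> eqij; change (i = j) in eqij; subst j.
have [le_ac|/ltnW le_ca] := leqP (g a) (g c); first exact: seg.
by rewrite within_connect_sym; apply: seg.
Qed.

End Straighten.
Arguments hang {n G u i} a.

Unset Implicit Arguments.

Theorem lemma3p1 (n : nat) (n_ge3 : 3 <= n)
    (lam : 'I_n -> nat) (lam_gt0 : forall i, 0 < lam i)
    (G : 'I_n -> sgraph)
    (cardG : forall i, #|G i| = lam i)
    (connG : forall i, connected_graph (G i))
    (u : forall i, G i) (mu : seq nat) :
  has_connected_partition (cycle_attach u) mu ->
  has_connected_partition (sun_graph lam_gt0) mu.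
Proof.
case=> P [connP <-].
have /andP[/and3P[/eqP covP trivP _] _] := connP.
have inP x : x \in cover P by rewrite covP.
(* The part of the cycle vertex i gets key 0, hence comes first along the i-th
   path; the other parts come in an arbitrary order. *)
pose key i (a : G i) :=
  if pblock P (hang a : cycle_attach u) == pblock P (on_cycle i) then 0
  else (enum_rank (pblock P (hang a : cycle_attach u))).+1.
have key_inj i (a b : G i) : key i a = key i b ->
    pblock P (hang a : cycle_attach u) = pblock P (hang b).
  rewrite /key; do 2!case: eqP => [->|_] //.
  by move=> [/val_inj/enum_rank_inj].
pose g i := s2val (monotone_numbering (key i) (cardG i)).
have inj_g i : injective (g i) := s2valP (monotone_numbering (key i) (cardG i)).
have mono_g i (a b : G i) : g i a <= g i b -> key i a <= key i b.
  exact: (s2valP' (monotone_numbering (key i) (cardG i))).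
have bij_g i : bijective (g i).
  by apply: inj_card_bij (inj_g i) _; rewrite card_ord cardG.
have partE A x : A \in P -> (x \in A) = (pblock P x == A).
  move=> PA; apply/idP/eqP => [|<-]; last by rewrite mem_pblock.
  exact: def_pblock.
have bij_f := straighten_bij lam_gt0 u cardG inj_g.
apply: (transfer_connected_partition bij_f connP).
move=> A PA /connected_inducedP[ntA connA].
apply/connected_inducedP; split; first by rewrite imset_eq0.
have [/existsP[i0 Ai0]|] := boolP [exists i, on_cycle i \in A].
  (* A vertex of A in G i has key 0, because A is then the part of i. *)
  apply: straighten_connected_on_cycle (Ai0) (connA) => // i a b Aa le_ba.
  have Ai := foot_in_part connA Ai0 Aa.
  have key_a : key i a = 0.
    move: Aa Ai; rewrite /key !partE // => /eqP-> /eqP ->.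
    by rewrite eqxx.
  have key_b : key i b = 0.
    by apply/eqP; rewrite -leqn0 -key_a mono_g.
  by move: Aa; rewrite !partE // (key_inj i b a) // key_b.
rewrite negb_exists => /forallP offA.
apply: straighten_connected_off_cycle offA connA => // i a b c Aa Ac.
case/andP=> /mono_g le_ab /mono_g le_bc.
have key_ac : key i a = key i c.
  move: Aa Ac; rewrite !partE // /key.
  by move=> /eqP-> /eqP->.
move: (Aa); rewrite !partE // (key_inj i b a) //.
by apply/eqP; rewrite eqn_leq le_ab {1}key_ac le_bc.
Qed.
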